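(* Let $\epsilon,\delta>0$, let $T$ be the number of iterations of the primal multiplicative weights LP algorithm (described in the context), and let $\epsilon'=\epsilon/\sqrt{8T\log(1/\delta)}$. If the dual oracle used by the algorithm is $\epsilon'$-differentially private with respect to changes of $b$ of at most $\Delta_\infty$ in $\ell_\infty$ norm (with $A$ and the query point fixed), then the primal multiplicative weights LP algorithm is $(\epsilon,\delta)$-low sensitivity scalar private with sensitivity $\Delta_\infty$.
   Context: Setting: feasibility LPs ''find $x\in\mathbb{R}^d_{\ge0}$ with $Ax\le b$'', $A\in\mathbb{R}^{m\times d}$, $b\in\mathbb{R}^m$. A randomized algorithm $\mathcal{M}(b,A)$ with output in $\mathbb{R}^d$ is $(\epsilon,\delta)$-low sensitivity scalar private with sensitivity $\Delta_\infty$ if for all $b,b'$ with $\|b-b'\|_\infty\le\Delta_\infty$ and every $S\subseteq\mathbb{R}^d$, $\Pr[\mathcal{M}(b,A)\in S]\le e^\epsilon\Pr[\mathcal{M}(b',A)\in S]+\delta$. An $(\alpha,\gamma)$-dual oracle, given $A,b$ and $x$, outputs $i\in[m]$ such that $A_ix-b_i\ge\max_j(A_jx-b_j)-\alpha$ with probability at least $1-\gamma$. Primal multiplicative weights LP algorithm (accuracy $\alpha$): let $\rho=\max_{ij}|A_{ij}|$, $T=9\rho^2\log d/\alpha^2$, $\eta=\sqrt{\log d/T}$, $\tilde x^1$ the uniform distribution on $[d]$. For $t=1,\dots,T$: $p^t=\mathrm{Oracle}(A,b,\tilde x^t)$; losses $\ell^t_i=A_{p^ti}/\rho$; $x^{t+1}_i=e^{-\eta\ell^t_i}\tilde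 x^t_i$ and $\tilde x^{t+1}=x^{t+1}/\sum_i x^{t+1}_i$. Output $\bar x=\frac1T\sum_t\tilde x^t$.
   Formalization: For δ<1 the formal theorem also assumes ε ≤ 8 log(1/δ); for arbitrary ε, δ > 0 the claim is false (e.g. T=2, ε=1, δ=exp(-2^-16), where ε'=64). T is rounded up to an integer. *)

(* Defs.v *)
From HB Require Import structures.
From mathcomp Require Import all_boot all_order all_algebra.
From mathcomp Require Import boolp classical_sets reals normedtype sequences exp.

Set Implicit Arguments.
Unset Strict Implicit.
Unset Printing Implicit Defensive.

Import Order.TTheory GRing.Theory Num.Theory.
Import numFieldNormedType.Exports.

Local Open Scope ring_scope.

(** A random element of [X] drawn by a finite experiment.  Two values with
    different sample spaces may have the same law; only [Pr] matters.  Every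
    oracle answers in the finite set ['I_m] and the algorithm makes finitely
    many calls, so all laws involved are finitely supported and [Pr] is defined
    on every subset of [X], without measurability conditions. *)
Record rand (R : realType) (X : Type) := Rand {
  sample : finType;
  weight : sample -> R;
  outcome : sample -> X;
  weight_ge0 : forall w, 0 <= weight w;
  weight_sum1 : \sum_w weight w = 1 }.

Definition Pr (R : realType) (X : Type) (mu : rand R X) (S : set X) : R :=
  \sum_(w : sample mu | `[< S (outcome w) >]) weight w.

Section Monad.
Variables (R : realType) (X Y : Type).

Lemma rret_ge0 (w : unit) : 0 <= (1 : R). Proof. exact: ler01. Qed.

Lemma rret_sum1 : \sum_(w : unit) (1 : R) = 1.
Proof. by rewrite big_const card_unit /= addr0. Qed.

Definition rret (x : X) : rand R X := Rand (fun _ => x) rret_ge0 rret_sum1.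

Variables (mu : rand R X) (f : X -> rand R Y).

Let bsample (w : sample mu) : finType := sample (f (outcome w)).

Let bweight (u : {w : sample mu & bsample w}) : R :=
  weight (tag u) * weight (tagged u).

Lemma rbind_ge0 u : 0 <= bweight u.
Proof. by rewrite mulr_ge0 // weight_ge0. Qed.

Lemma rbind_sumE (Q : pred Y) :
  \sum_(u | Q (outcome (tagged u))) bweight u =
  \sum_(w : sample mu) weight w *
    \sum_(v : bsample w | Q (outcome v)) weight v.
Proof.
under [RHS]eq_bigr do rewrite big_distrr /=.
by rewrite (sig_big_dep _ _ (fun w (v : bsample w) => weight w * weight v)).
Qed.

Lemma rbind_sum1 : \sum_u bweight u = 1.
Proof.
rewrite (rbind_sumE predT) -(weight_sum1 mu); apply: eq_bigr => w _.
by rewrite weight_sum1 mulr1.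
Qed.

(** Draw [x] from [mu], then draw from [f x] with fresh randomness. *)
Definition rbind : rand R Y :=
  Rand (fun u : {w : sample mu & bsample w} => outcome (tagged u))
    rbind_ge0 rbind_sum1.

Lemma Pr_rret (x : X) (S : set X) : Pr (rret x) S = (`[< S x >])%:R.
Proof.
by rewrite /Pr /= big_mkcond big_const card_unit /= addr0; case: ifP.
Qed.

Lemma Pr_rbind (S : set Y) :
  Pr rbind S = \sum_(w : sample mu) weight w * Pr (f (outcome w)) S.
Proof. exact: (rbind_sumE (fun y => `[< S y >])). Qed.

End Monad.

(** On matrices and vectors [`| _ |] is the maximum absolute value of the
    entries.  [M] is a function of the private vector [b] alone, everything else
    being held fixed. *)
Definition low_sensitivity_scalar_private (R : realType) (m : nat) (X : Type)
    (eps delta Dinf : R) (M : 'cV[R]_m -> rand R X) : Prop :=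
  forall b b' : 'cV[R]_m, `|b - b'| <= Dinf ->
  forall S : set X, Pr (M b) S <= expR eps * Pr (M b') S + delta.

Definition oracle (R : realType) (m d : nat) : Type :=
  'M[R]_(m, d) -> 'cV[R]_m -> 'cV[R]_d -> rand R 'I_m.

Definition dual_oracle (R : realType) (m d : nat) (alpha gamma : R)
    (orc : oracle R m d) : Prop :=
  forall A b x,
    1 - gamma <= Pr (orc A b x)
      [set i | forall j,
        (A *m x - b) j 0 - alpha <= (A *m x - b) i 0]%classic.

Section MultiplicativeWeights.
Variables (R : realType) (m d : nat) (alpha : R).
Variables (orc : oracle R m d) (A : 'M[R]_(m, d)) (b : 'cV[R]_m).

Definition mw_width : R := `|A|.

(** The prescribed number of rounds is rounded up to an integer; that integer
    is used wherever the number of rounds occurs.  It is 0 only when [d <= 1] or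
    [A = 0], in which case the algorithm returns the zero vector. *)
Definition mw_rounds : nat :=
  `|Num.ceil (9 * mw_width ^+ 2 * ln (d%:R : R) / alpha ^+ 2)|%N.

Definition mw_eta : R := Num.sqrt (ln (d%:R : R) / mw_rounds%:R).

Definition mw_uniform : 'cV[R]_d := const_mx d%:R^-1.

Definition mw_loss (p : 'I_m) (i : 'I_d) : R := A p i / mw_width.

Definition mw_reweight (x : 'cV[R]_d) (p : 'I_m) : 'cV[R]_d :=
  \col_i (expR (- mw_eta * mw_loss p i) * x i 0).

Definition mw_update (x : 'cV[R]_d) (p : 'I_m) : 'cV[R]_d :=
  (\sum_i mw_reweight x p i 0)^-1 *: mw_reweight x p.

(** [n] further rounds from the current distribution [x], where [s] is the sum
    of the distributions of the previous rounds. *)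
Fixpoint mw_loop (n : nat) (x s : 'cV[R]_d) : rand R 'cV[R]_d :=
  if n is n'.+1 then
    rbind (orc A b x) (fun p => mw_loop n' (mw_update x p) (s + x))
  else rret R s.

Definition mw_lp : rand R 'cV[R]_d :=
  rbind (mw_loop mw_rounds mw_uniform 0)
    (fun s => rret R (mw_rounds%:R^-1 *: s)).

End MultiplicativeWeights.

(* Main.v *)
Require Import Defs.
From mathcomp Require Import all_boot all_order all_algebra.
From mathcomp Require Import boolp classical_sets reals normedtype sequences exp.
From mathcomp Require Import ring lra.
From mathcomp Require Import interval_inference functions topology derive convex hoelder.

Import Order.TTheory GRing.Theory Num.Theory.
Import numFieldNormedType.Exports.

Local Open Scope ring_scope.

(** Conditioning on one query at a time gives, for every [lam >= 0] and every
    threshold [a],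
      [Pr (M b) S <= e^a * Pr (M b') S + e^(- lam * a) * K ^ T],
    where [K] bounds the moment generating function at [lam] of the privacy loss
    [ln (P i / Q i)], [i] drawn from [P], of one oracle answer.  For an
    [e]-private oracle [K = exp (lam * (lam + 1) * e ^ 2 / 2)] (the Renyi bound),
    so [T] answers lose only of order [sqrt T * e], and [a = eps], [lam] of order
    [ln (1 / delta) / eps] finish the proof.  Later query points depend on the
    data only through earlier answers, so the induction fixes the query point. *)

(** * Inequalities for hyperbolic functions *)

Lemma ler_of_ge0_derive (R : realType) (f f' : R -> R) :
  (forall x : R, is_derive x (1 : R) f (f' x)) ->
  (forall x, 0 <= x -> 0 <= f' x) ->
  forall x y, 0 <= x -> x <= y -> f x <= f y.
Proof.
move=> df f'_ge0; apply: ger0_derive1_ndecry => [x _|x|].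
- by apply: ex_derive; exact: df.
- by rewrite in_itv /= andbT derive1E derive_val => /ltW; exact: f'_ge0.
- apply: continuous_subspaceT => x.
  by apply/differentiable_continuous/derivable1_diffP; apply: ex_derive; exact: df.
Qed.

Section CoshRatio.
Variable R : realType.
Implicit Types x y : R.

Lemma is_derive_expRN x : is_derive x (1 : R) (expR \o -%R) (- expR (- x)).
Proof. apply: is_derive_eq; rewrite /GRing.scale /=; ring. Qed.

(** Right side minus left side vanishes at 0 and has derivative [x * (expR x - expR (- x))]. *)
Lemma sinh_le_mul_cosh x : 0 <= x ->
  expR x - expR (- x) <= x * (expR x + expR (- x)).
Proof.
move=> x0.
pose f : R -> R := (@id R : R -> R) * (expR + (expR \o -%R)) - (expR - (expR \o -%R)).
have df (y : R) : is_derive y (1 : R) f (y * (expR y - expR (- y))).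
  have dN := is_derive_expRN y.
  apply: is_derive_eq; rewrite /GRing.scale /= !fctE /=. ring.
have := ler_of_ge0_derive _ _ _ df _ _ _ (lexx 0) x0.
rewrite /f !fctE /= mul0r oppr0 subrr subr0 subr_ge0; apply=> y y0.
by rewrite mulr_ge0 // subr_ge0 ler_expR; lra.
Qed.

(** [cosh z * expR (- z ^+ 2 / 2)] decreases for [z >= 0]: its derivative has the sign of
    [sinh z - z * cosh z]. Below, [f] is minus twice this function. *)
Lemma cosh_ratio_le x y : 0 <= x -> x <= y ->
  (expR y + expR (- y)) * expR (x ^+ 2 / 2) <=
  (expR x + expR (- x)) * expR (y ^+ 2 / 2).
Proof.
move=> x0 xy.
pose f : R -> R := - ((expR + (expR \o -%R)) * (expR \o (- 2^-1 \*: ((@id R : R -> R) * (@id R : R -> R))))).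
have df (z : R) : is_derive z (1 : R) f
    ((z * (expR z + expR (- z)) - (expR z - expR (- z))) * expR (- (z ^+ 2 / 2))).
  have dN := is_derive_expRN z.
  apply: is_derive_eq; rewrite /GRing.scale /= !fctE /=.
  have -> : - (z ^+ 2 / 2) = - 2^-1 *: (z * z) by rewrite /GRing.scale /=; ring.
  by field.
have f'_ge0 (z : R) : 0 <= z ->
    0 <= (z * (expR z + expR (- z)) - (expR z - expR (- z))) * expR (- (z ^+ 2 / 2)).
  by move=> z0; rewrite mulr_ge0 ?expR_ge0 // subr_ge0 sinh_le_mul_cosh.
have := ler_of_ge0_derive _ _ _ df f'_ge0 _ _ x0 xy.
have E (z : R) : - 2^-1 *: (z * z) = - (z ^+ 2 / 2) by rewrite /GRing.scale /=; ring.
rewrite /f !fctE /= lerN2 !E !expRN.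
by rewrite ler_pdivrMr ?expR_gt0 // mulrAC ler_pdivlMr ?expR_gt0.
Qed.

End CoshRatio.

(** * Moment bound for the privacy loss of one answer *)

Section RenyiDivergence.
Variables (R : realType).

(** The convex function [r ^ p] lies below its chord over [[e^-e, e^e]]; take [r = expR z] and clear
    the denominator. *)
Lemma expR_chord (p e z : R) : 1 <= p -> 0 < e -> `|z| <= e ->
  expR (p * z) * (expR e - expR (- e)) <=
  (expR z - expR (- e)) * expR (p * e) + (expR e - expR z) * expR (- (p * e)).
Proof.
move=> p1 e0; rewrite ler_norml => /andP[ez ze].
have D0 : 0 < expR e - expR (- e) by rewrite subr_gt0 ltr_expR; lra.
pose t := (expR z - expR (- e)) / (expR e - expR (- e)).
have t0 : 0 <= t by rewrite divr_ge0 ?subr_ge0 ?ler_expR //; exact: le_trans ze.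
have t1 : t <= 1 by rewrite ler_pdivrMr // mul1r lerD2r ler_expR.
have := @convex_powR R p p1 (Itv01 t0 t1) (expR e) (expR (- e)).
rewrite !inE /= !in_itv /= !andbT !expR_ge0 => /(_ isT isT).
rewrite convRE [X in X `^ _]convRE /= /unstable.onem -!expRM.
have -> : t * expR e + (1 - t) * expR (- e) = expR z.
  by rewrite /t; field; rewrite gt_eqF.
rewrite -expRM -(ler_pM2r D0) [z * p]mulrC [e * p]mulrC mulNr [e * p]mulrC.
move=> /le_trans; apply; rewrite le_eqVlt; apply/orP; left; apply/eqP.
by rewrite /t; field; rewrite gt_eqF.
Qed.

(* Among ratios in [[e^-e, e^e]] of mean 1, the power mean is largest when only
   the two extreme ratios occur; it is then a quotient of hyperbolic cosines. *)
Lemma renyi_divergence_le (I : finType) (P Q : I -> R) (lam e : R) :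
  0 <= lam -> 0 < e ->
  (forall i, 0 <= P i) -> (forall i, 0 <= Q i) ->
  \sum_i P i = 1 -> \sum_i Q i = 1 ->
  (forall i, P i <= expR e * Q i) -> (forall i, Q i <= expR e * P i) ->
  \sum_i P i * expR (lam * ln (P i / Q i)) <= expR (lam * (lam + 1) * e ^+ 2 / 2).
Proof.
move=> lam0 e0 P0 Q0 P1 Q1 PQ QP.
pose p := lam + 1; have p1 : 1 <= p by rewrite /p; lra.
have D0 : 0 < expR e - expR (- e) by rewrite subr_gt0 ltr_expR; lra.
set U := expR (p * e); set V := expR (- (p * e)).
(* With [r = P i / Q i], the summand [P i * r ^ lam] is [Q i * r ^ p], so the chord bound applies.
   It is linear in [P i] and [Q i], hence sums to constants. *)
have term i : P i * expR (lam * ln (P i / Q i)) * (expR e - expR (- e)) <=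
    (P i - expR (- e) * Q i) * U + (expR e * Q i - P i) * V.
  have [Qi0|Qi0] := eqVneq (Q i) 0.
    have Pi0 : P i = 0.
      by apply/eqP; rewrite eq_le P0 andbT -(mulr0 (expR e)) -Qi0.
    by rewrite Qi0 Pi0 !(mulr0, mul0r, subr0, addr0).
  have Qi : 0 < Q i by rewrite lt_def Qi0 Q0.
  have Pi : 0 < P i.
    by rewrite -(pmulr_rgt0 _ (expR_gt0 e)); exact: lt_le_trans (QP i).
  have PQi : 0 < P i / Q i by rewrite divr_gt0.
  have lnPQ : `|ln (P i / Q i)| <= e.
    rewrite ler_norml; apply/andP; split.
      by rewrite -(ler_expR (- e)) lnK // expRN ler_pdivlMr // mulrC ler_pdivrMr ?expR_gt0 // mulrC.
    by rewrite -ler_expR lnK // ler_pdivrMr.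
  have := expR_chord p e _ p1 e0 lnPQ.
  rewrite /p mulrDl mul1r expRD lnK // -(ler_pM2l Qi) => H.
  apply: le_trans (le_trans H _); rewrite le_eqVlt; apply/orP; left; apply/eqP.
    by field.
  by rewrite -/p -/U -/V; field.
rewrite -(ler_pM2r D0) mulr_suml; apply: le_trans (ler_sum _ _) _ => [i _|].
  exact: term.
rewrite big_split /= -!mulr_suml !sumrB -!mulr_sumr P1 Q1 !mulr1.
(* The summed bound is [(1 - e^-e) * U + (e^e - 1) * V] over [e^e - e^-e]. Cancelling [e^x - e^-x]
   leaves [cosh y / cosh x]. *)
pose x := e / 2; pose y := p * e - x.
have x0 : 0 <= x by rewrite /x; lra.
have xy : x <= y.
  have -> : y = x + lam * e by rewrite /y /x /p; field.
  by rewrite lerDl mulr_ge0 // ltW.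
have w0 : 0 <= expR x - expR (- x) by rewrite subr_ge0 ler_expR; lra.
have := cosh_ratio_le R x y x0 xy.
have -> : y ^+ 2 / 2 = lam * (lam + 1) * e ^+ 2 / 2 + x ^+ 2 / 2.
  by rewrite /y /x /p; field.
rewrite [expR (_ + x ^+ 2 / 2)]expRD [X in _ <= X -> _]mulrA ler_pM2r ?expR_gt0 // => /(ler_wpM2r w0).
have -> : expR y = U * expR (- x) by rewrite -expRD.
have -> : expR (- y) = V * expR x by rewrite -expRD; congr expR; rewrite /y; ring.
have -> : expR e = expR x ^+ 2 by rewrite expr2 -expRD; congr expR; rewrite /x; field.
have -> : expR (- e) = expR (- x) ^+ 2.
  by rewrite expr2 -expRD; congr expR; rewrite /x; field.
have vw : expR x * expR (- x) = 1 by rewrite -expRD subrr expR0.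
move: vw; set v := expR x; set w := expR (- x); set B := expR _ => vw.
rewrite (_ : _ * (v - w) = (v * w - w ^+ 2) * U + (v ^+ 2 - v * w) * V); last by ring.
by rewrite vw => /le_trans; apply; rewrite le_eqVlt; apply/orP; left; apply/eqP; ring.
Qed.

End RenyiDivergence.

(** * Composition of two draws *)

Section Composition.
Variable R : realType.

Lemma Pr_ge0 (X : Type) (mu : rand R X) (S : set X) : 0 <= Pr mu S.
Proof. by apply: sumr_ge0 => w _; exact: weight_ge0. Qed.

Lemma Pr_le1 (X : Type) (mu : rand R X) (S : set X) : Pr mu S <= 1.
Proof.
rewrite -(weight_sum1 mu) [leRHS](bigID (fun w => `[< S (outcome w) >])) /= lerDl.
by apply: sumr_ge0 => w _; exact: weight_ge0.
Qed.

Lemma Pr_set1E (I : finType) (mu : rand R I) (i : I) :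
  Pr mu [set i] = \sum_(w : sample mu | outcome w == i) weight w.
Proof.
by apply: eq_bigl => w; apply/asboolP/eqP.
Qed.

Lemma sum_Pr_set1 (I : finType) (mu : rand R I) : \sum_i Pr mu [set i] = 1.
Proof.
rewrite -(weight_sum1 mu) (partition_big (fun w => outcome w) xpredT) //=.
by apply: eq_bigr => i _; rewrite Pr_set1E.
Qed.

Lemma Pr_rbind_fin (I : finType) (X : Type) (mu : rand R I) (f : I -> rand R X)
    (S : set X) :
  Pr (rbind mu f) S = \sum_i Pr mu [set i] * Pr (f i) S.
Proof.
rewrite Pr_rbind (partition_big (fun w => outcome w) xpredT) //=.
apply: eq_bigr => i _; rewrite Pr_set1E mulr_suml.
by apply: eq_bigr => w /eqP ->.
Qed.

(* A likelihood ratio [P i / Q i] seen at this draw lowers the threshold [a]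
   left for the remaining ones, so the error terms multiply like moment
   generating functions of the privacy loss. *)
Lemma rbind_private (I : finType) (X : Type) (mu nu : rand R I)
    (f g : I -> rand R X) (S : set X) (lam e K : R) :
  0 <= lam -> 0 < e -> 0 <= K ->
  (forall i, Pr mu [set i] <= expR e * Pr nu [set i]) ->
  (forall i, Pr nu [set i] <= expR e * Pr mu [set i]) ->
  (forall i (a : R), Pr (f i) S <= expR a * Pr (g i) S + expR (- (lam * a)) * K) ->
  forall a : R, Pr (rbind mu f) S <= expR a * Pr (rbind nu g) S +
    expR (- (lam * a)) * (expR (lam * (lam + 1) * e ^+ 2 / 2) * K).
Proof.
move=> lam0 e0 K0 munu numu fg a; rewrite !Pr_rbind_fin.
have := renyi_divergence_le R I (fun i => Pr mu [set i]) (fun i => Pr nu [set i]) lam e lam0 e0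
  (fun i => Pr_ge0 _ _ _) (fun i => Pr_ge0 _ _ _) (sum_Pr_set1 _ _)
  (sum_Pr_set1 _ _) munu numu.
set B := expR (_ / 2) => renyi.
have step i : Pr mu [set i] * Pr (f i) S <= expR a * (Pr nu [set i] * Pr (g i) S)
    + expR (- (lam * a)) * K * (Pr mu [set i] *
        expR (lam * ln (Pr mu [set i] / Pr nu [set i]))).
  have [mu0|mu0] := eqVneq (Pr mu [set i]) 0.
    by rewrite mu0 !mul0r mulr0 addr0 !mulr_ge0 ?expR_ge0 ?Pr_ge0.
  have mui : 0 < Pr mu [set i] by rewrite lt_def mu0 Pr_ge0.
  have nui : 0 < Pr nu [set i].
    by rewrite -(pmulr_rgt0 _ (expR_gt0 e)); exact: lt_le_trans (munu i).
  (* This threshold turns the weight under [mu] into exactly [expR a] times that under [nu]. *)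
  have := fg i (a - ln (Pr mu [set i] / Pr nu [set i])).
  rewrite expRD expRN lnK ?posrE ?divr_gt0 //.
  rewrite (_ : - (lam * _) = - (lam * a) + lam * ln (Pr mu [set i] / Pr nu [set i])); last by ring.
  rewrite expRD => /(ler_wpM2l (ltW mui)) /le_trans; apply.
  rewrite le_eqVlt; apply/orP; left; apply/eqP.
  by field; rewrite mu0 gt_eqF.
apply: le_trans (ler_sum _ (fun i _ => step i)) _.
rewrite big_split /= -!mulr_sumr lerD2l -mulrA ler_pM2l ?expR_gt0 //.
by rewrite mulrC ler_wpM2r.
Qed.

End Composition.

Lemma low_sensitivity_scalar_private_map (R : realType) (m : nat) (X Y : Type)
    (eps delta Dinf : R) (M : 'cV[R]_m -> rand R X) (h : X -> Y) :
  low_sensitivity_scalar_private eps delta Dinf M ->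
  low_sensitivity_scalar_private eps delta Dinf
    (fun b => rbind (M b) (fun x => rret R (h x))).
Proof.
move=> MP b b' bb' S.
have E c : Pr (rbind (M c) (fun x => rret R (h x))) S = Pr (M c) (h @^-1` S)%classic.
  rewrite Pr_rbind [RHS]big_mkcond; apply: eq_bigr => w _.
  by rewrite Pr_rret /preimage /=; case: asboolP => _; rewrite ?mulr1 ?mulr0.
by rewrite !E; exact: MP.
Qed.

(** * Induction over the rounds *)

Section Loop.
Variables (R : realType) (m d : nat) (A : 'M[R]_(m, d)) (alpha : R).
Variables (orc : oracle R m d) (Dinf e : R).
Hypothesis e_gt0 : 0 < e.
Hypothesis orc_private : forall x : 'cV[R]_d,
  low_sensitivity_scalar_private e 0 Dinf (fun b => orc A b x).

Lemma mw_loop_private (lam : R) (b b' : 'cV[R]_m) (S : set 'cV[R]_d) :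
  0 <= lam -> `|b - b'| <= Dinf ->
  forall n (x s : 'cV[R]_d) (a : R),
  Pr (mw_loop alpha orc A b n x s) S <=
    expR a * Pr (mw_loop alpha orc A b' n x s) S +
    expR (- (lam * a)) * expR (lam * (lam + 1) * e ^+ 2 / 2) ^+ n.
Proof.
move=> lam0 bb'; elim=> [|n IHn] x s a.
  rewrite expr0 mulr1 /= !Pr_rret; case: asboolP => _; last first.
    by rewrite mulr0 add0r expR_ge0.
  (* With no round left, one of [expR a] and [expR (- (lam * a))] is at least 1. *)
  rewrite mulr1; have [a0|/ltW a0] := leP 0 a.
    by rewrite -[leLHS]addr0 lerD ?expR_ge0 // -expR0 ler_expR.
  rewrite -[leLHS]add0r lerD ?expR_ge0 // -expR0 ler_expR oppr_ge0.
  by rewrite mulr_ge0_le0.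
rewrite exprS /=; apply: rbind_private => // i.
- by have := orc_private x b b' bb' [set i]%classic; rewrite addr0.
- have b'b : `|b' - b| <= Dinf by rewrite distrC.
  by have := orc_private x b' b b'b [set i]%classic; rewrite addr0.
Qed.

End Loop.

Theorem theorem20 (R : realType) (m d : nat) (A : 'M[R]_(m, d)) (alpha : R)
    (orc : oracle R m d) (alpha_orc gamma Dinf eps delta : R)
    (alpha_gt0 : 0 < alpha)
    (orc_dual : dual_oracle alpha_orc gamma orc)
    (eps_gt0 : 0 < eps) (delta_gt0 : 0 < delta)
    (eps_delta : delta < 1 -> eps <= 8 * ln (delta^-1)) :
  let T := mw_rounds alpha A in
  let eps' := eps / Num.sqrt (8 * T%:R * ln (delta^-1)) in
  (forall x : 'cV[R]_d,
     low_sensitivity_scalar_private eps' 0 Dinf (fun b => orc A b x)) ->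
  low_sensitivity_scalar_private eps delta Dinf (fun b => mw_lp alpha orc A b).
Proof.
move=> T eps' orc_private.
(* Averaging is post-processing of the loop's sum. *)
apply: low_sensitivity_scalar_private_map => b b' bb' S.
have [delta1|delta1] := leP 1 delta.
  by rewrite (le_trans (Pr_le1 _ _ _ _)) // -[leLHS]add0r lerD ?mulr_ge0 ?expR_ge0 ?Pr_ge0.
(* For [T = 0] the oracle is never called and both laws agree. *)
rewrite -/T; case: (posnP T) => [->|T_gt0] /=.
  rewrite -[leLHS]addr0 lerD ?(ltW delta_gt0) //.
  by rewrite ler_peMl ?Pr_ge0 // -expR0 ler_expR ltW.
set L := ln (delta^-1).
have L_gt0 : 0 < L by rewrite ln_gt0 // invf_gt1.
have TL_gt0 : 0 < 8 * T%:R * L by rewrite !mulr_gt0 ?ltr0n.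
have eps'_gt0 : 0 < eps' by rewrite divr_gt0 ?sqrtr_gt0.
(* [lam = 4 L / eps] makes the exponent [- 3 L + eps / 4], at most [- L]. *)
have lam0 : 0 <= 4 * L / eps by rewrite ltW ?divr_gt0 ?mulr_gt0.
apply: le_trans (mw_loop_private _ _ _ _ alpha _ _ _ eps'_gt0 orc_private _ _ _ S lam0 bb'
  T _ _ eps) _.
rewrite lerD2l -expRM_natl -expRD.
have -> : delta = expR (- L) by rewrite /L lnV ?posrE // opprK lnK ?posrE.
rewrite ler_expR /eps' expr_div_n sqr_sqrtr ?(ltW TL_gt0) // -/L.
(* The [T] rounds contribute [lam * (lam + 1) * eps ^+ 2 / (16 * L) = L + eps / 4], the threshold
   [- lam * eps = - 4 * L]. *)
rewrite (_ : _ + _ = - (3 * L) + eps / 4); last first.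
  by field; rewrite !gt_eqF ?ltr0n.
have := eps_delta delta1; rewrite -/L; lra.
Qed.
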